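(* Let $d\ge 2$ be an integer, and let $(X_n)_{n\in\mathbb{Z}_+}$ be the random walk on the $d$-dimensional Manhattan lattice $M_d$ started at $X_0=0\in\mathbb{Z}^d$. Then for every $n\in\mathbb{Z}_+$, $$\mathbb{E}_d[X_n]=\left(\sum_{i=1}^d e_i\right)\left[\frac{1-\big(\frac{2-d}{d}\big)^n}{2(d-1)}\right]$$ and $$\mathbb{E}_d\big[|X_n|^2\big]=\frac{\big(2(d-1)n-1\big)d^n+(2-d)^n}{d^{n-1}\,2(d-1)^2}.$$
   Context: Let $\mathbb{Z}_+=\{0,1,2,\dots\}$, $[d]=\{1,\dots,d\}$, and let $e_1,\dots,e_d$ be the standard basis vectors of $\mathbb{Z}^d$. Write $x=(x^{[1]},\dots,x^{[d]})$ for $x\in\mathbb{Z}^d$, and let $|\cdot|$ denote the Euclidean norm. The Manhattan lattice in $d\ge 2$ dimensions is the directed graph $M_d=(V,E)$ with vertex set $V=\mathbb{Z}^d$ and directed edge set $E$ consisting only of nearest-neighbour edges, defined as follows: for every $x\in\mathbb{Z}^d$ and $i\in[d]$, - $(x,x+e_i)\in E$ if and only if $\sum_{j\neq i}x^{[j]}$ is even; - $(x,x-e_i)\in E$ if and only if $\sum_{j\neq i}x^{[j]}$ is odd. Thus exactly $d$ directed edges point out of each vertex. The random walk on $M_d$ is the Markov chain $(X_n)_{n\in\mathbb{Z}_+}$ on $\mathbb{Z}^d$ with $X_0=0$ and transition probabilities $p_{x,y}=1/d$ if $(x,y)\in E$ and $p_{x,y}=0$ otherwise. $\mathbb{E}_d$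 denotes expectation for this walk in dimension $d$, and $\mathbb{E}_d[X_n]$ is the vector $(\mathbb{E}_d[X_n^{[1]}],\dots,\mathbb{E}_d[X_n^{[d]}])$. The convention $0^0=1$ is used (relevant when $d=2$, $n=0$). *)

(* Defs.v *)
From HB Require Import structures.
From mathcomp Require Import all_boot all_order all_algebra.
From mathcomp Require Import all_classical all_reals all_analysis.

Set Implicit Arguments.
Unset Strict Implicit.
Unset Printing Implicit Defensive.

Import Order.TTheory GRing.Theory Num.Theory.
Import numFieldNormedType.Exports.

Local Open Scope classical_set_scope.
Local Open Scope ring_scope.

(* Z^d is 'rV[int]_d, with coordinates indexed from 0. *)

Definition unit_vec (A : pzRingType) (d : nat) (i : 'I_d) : 'rV[A]_d :=
  delta_mx 0 i.

Definition manhattan_edge (d : nat) (x y : 'rV[int]_d) : bool :=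
  [exists i : 'I_d,
     if (2 %| \sum_(j < d | j != i) x 0 j)%Z
     then y == x + unit_vec int i
     else y == x - unit_vec int i].

Definition manhattan_kernel (R : realType) (d : nat) (x y : 'rV[int]_d) : R :=
  if manhattan_edge x y then d%:R^-1 else 0.

(* X is a Markov chain with countable state space S (carrying its discrete
   sigma-algebra), initial state x0 and transition probabilities p.  The Markov property
   P(X_{n+1} = s_{n+1} | X_0 = s_0, ..., X_n = s_n) = p(s_n, s_{n+1})
   is written in product form, so that it is trivial when the conditioning
   event is null. *)
Definition markov_chain (R : realType) (disp : measure_display)
    (Omega : measurableType disp) (P : probability Omega R) (S : countType)
    (x0 : S) (p : S -> S -> R) (X : nat -> Omega -> S) : Prop :=
  [/\ forall (n : nat) (A : set S), measurable (X n @^-1` A),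
      P [set w | X 0%N w = x0] = 1%E &
      forall (n : nat) (s : nat -> S),
        P [set w | forall k, (k <= n.+1)%N -> X k w = s k] =
        (P [set w | forall k, (k <= n)%N -> X k w = s k]
         * (p (s n) (s n.+1))%:E)%E].

Definition manhattan_walk (R : realType) (disp : measure_display)
    (Omega : measurableType disp) (P : probability Omega R) (d : nat)
    (X : nat -> Omega -> 'rV[int]_d) : Prop :=
  markov_chain P (0 : 'rV[int]_d) (@manhattan_kernel R d) X.

(* The library's norm on 'rV is the sup norm, hence this definition. *)
Definition euclidean_norm (R : realType) (d : nat) (x : 'rV[int]_d) : R :=
  Num.sqrt (\sum_(i < d) (x 0 i)%:~R ^+ 2).

(* Coordinatewise expectation; its entries are a priori extended reals. *)
Definition expectation_vec (R : realType) (disp : measure_display)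
    (Omega : measurableType disp) (P : probability Omega R) (d : nat)
    (Y : Omega -> 'rV[int]_d) : 'rV[\bar R]_d :=
  \row_(i < d) 'E_P[fun w => (Y w 0 i)%:~R]%E.

(* Main.v *)
(* The expectation of g(X_n) is the n-th iterate at the origin of the averaging
   operator T g x = (1/d) sum_i g (x + s_i(x) e_i), where s_i(x) = +-1 is the
   orientation of the i-th street through x.  A step along e_j keeps s_j and
   flips every other s_i, so with r = (2 - d)/d and f x = sum_i s_i(x) x_i
     T x_i = x_i + s_i / d,            T s_i = r s_i,
     T |x|^2 = |x|^2 + 1 + (2/d) f,    T f = r f + 1,
   and these two triangular recurrences are solved explicitly. *)
Require Import Defs.
From HB Require Import structures.
From mathcomp Require Import all_boot all_order all_algebra.
From mathcomp Require Import all_classical all_reals all_analysis.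
From mathcomp Require Import measurable_realfun.
From mathcomp Require Import zify ring.

Set Implicit Arguments.
Unset Strict Implicit.
Unset Printing Implicit Defensive.

Import Order.TTheory GRing.Theory Num.Theory.
Import numFieldNormedType.Exports.

Local Open Scope classical_set_scope.
Local Open Scope ring_scope.

(** * Averaging over labelled moves and its iterates *)

Definition transition_op (R : realType) (S : Type) (I : finType)
    (step : S -> I -> S) (g : S -> R) (x : S) : R :=
  #|I|%:R^-1 * \sum_(i : I) g (step x i).

Lemma transition_op_affine (R : realType) (S : Type) (I : finType)
    (step : S -> I -> S) (f g : S -> R) (b c : R) (x : S) :
  (0 < #|I|)%N ->
  transition_op step (fun y => f y + b * g y + c) x =
  transition_op step f x + b * transition_op step g x + c.
Proof.
move=> I0; have I_neq0 : #|I|%:R != 0 :> R by rewrite pnatr_eq0 -lt0n.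
rewrite /transition_op !big_split/= -mulr_sumr sumr_const -(mulr_natr c).
by field.
Qed.

(** Two consecutive states determine the move between them, so a trajectory determines its word of
    moves. This makes the path events below disjoint. *)
Lemma foldl_take_inj (S : eqType) (I : finType) (step : S -> I -> S) (x0 : S)
    (n : nat) :
  (forall x, injective (step x)) ->
  forall v w : n.-tuple I,
    (forall k, (k <= n)%N -> foldl step x0 (take k v) = foldl step x0 (take k w)) ->
    v = w.
Proof.
move=> step_inj v w vw; apply/eq_from_tnth => i.
have := vw _ (ltn_ord i).
rewrite (take_nth (tnth v i)) ?size_tuple// (take_nth (tnth v i)) ?size_tuple//.
rewrite !foldl_rcons vw 1?ltnW// => /step_inj.
by rewrite -!tnth_nth.
Qed.

Lemma iter_transition_op (R : realType) (S : Type) (I : finType)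
    (step : S -> I -> S) (n : nat) (g : S -> R) (x : S) :
  iter n (transition_op step) g x =
  #|I|%:R^-1 ^+ n * \sum_(w : n.-tuple I) g (foldl step x w).
Proof.
elim: n x => [|n IH] x.
  rewrite expr0 mul1r (big_pred1 [tuple])//= => w.
  by apply/esym/eqP; exact: tuple0.
(* The outermost averaging makes the first move out of [x], matching [foldl], which consumes its
   word from the head. *)
rewrite iterS /transition_op exprS -mulrA; congr (_ * _).
rewrite (eq_bigr _ (fun i _ => IH (step x i))) -mulr_sumr; congr (_ * _).
rewrite pair_bigA /=.
rewrite [RHS](reindex (fun p : I * n.-tuple I => [tuple of p.1 :: p.2])) //.
exists (fun w : n.+1.-tuple I => (thead w, [tuple of behead w])) => [[i w] _|w _] /=.
  by congr pair; apply/val_inj.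
by rewrite -tuple_eta.
Qed.

(** * From the law of the chain to iterates of the averaging operator *)

Section MarkovExpectation.
Variables (R : realType) (disp : measure_display) (Omega : measurableType disp).
Variables (P : probability Omega R) (S : countType) (I : finType).
Variables (x0 : S) (step : S -> I -> S) (p : S -> S -> R).
Variable X : nat -> Omega -> S.
Hypothesis step_inj : forall x, injective (step x).
Hypothesis p_step : forall x i, p x (step x i) = #|I|%:R^-1.
Hypothesis hX : markov_chain P x0 p X.

(** Shaped like the cylinders of [markov_chain], so that its product formula applies directly. The
    length [n] is separate from [w], which allows induction on [n] with the word fixed. *)
Let path_event (w : seq I) (n : nat) : set Omega :=
  [set o | forall k, (k <= n)%N -> X k o = foldl step x0 (take k w)].

Lemma measurable_path_event w n : measurable (path_event w n).
Proof.
have [mX _ _] := hX.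
have -> : path_event w n =
    \bigcap_(k in [set k | (k <= n)%N]) X k @^-1` [set foldl step x0 (take k w)].
  by apply/seteqP; split.
exact: bigcap_measurableType.
Qed.

Lemma probability_path_event w n : (n <= size w)%N ->
  P (path_event w n) = (#|I|%:R^-1 ^+ n)%:E.
Proof.
have [_ X0 XS] := hX.
elim: n => [|n IH] nw.
  rewrite expr0 -X0; congr (P _); apply/seteqP; split => o /=.
    by move=> /(_ 0%N isT); rewrite take0.
  by move=> Xo [|//] _; rewrite take0.
have [i0 _] : exists i : I, True.
  by case: w nw {IH} => // i w _; exists i.
rewrite /path_event (XS n (fun k => foldl step x0 (take k w))).
rewrite -/(path_event w n) IH 1?ltnW// (take_nth i0)// foldl_rcons p_step.
by rewrite -EFinM exprSr.
Qed.

(* The #|I|^n path events are disjoint and of total mass 1, hence X_n is almost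
   surely the endpoint of one of these paths. *)
Lemma expectation_markov_chain n (g : S -> R) :
  (0 < #|I|)%N ->
  ('E_P[fun o => g (X n o)])%E = (iter n (transition_op step) g x0)%:E.
Proof.
move=> I0; have [mX _ _] := hX.
pose A (w : n.-tuple I) := path_event w n.
pose D := \big[setU/set0]_(w : n.-tuple I) A w.
have mA w : measurable (A w) by exact: measurable_path_event.
have PA w : P (A w) = (#|I|%:R^-1 ^+ n)%:E.
  by apply: probability_path_event; rewrite size_tuple.
have mD : measurable D by apply: bigsetU_measurable.
have tA : trivIset [set: n.-tuple I] A.
  move=> v w _ _ [z [vo wo]]; apply: (foldl_take_inj step_inj (x0 := x0)).
  by move=> k kn; rewrite -vo// -wo.
have tA' : trivIset [set` index_enum (n.-tuple I)] A by exact: sub_trivIset tA.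
have mg (B : set Omega) : measurable_fun B (EFin \o (fun o => g (X n o))).
  apply: (@measurable_funS _ _ _ _ setT) => //.
  apply/measurable_EFinP => _ C mC; rewrite setTI.
  exact: (mX n (g @^-1` C)).
(* A function constant on each path event integrates over [D] to the average of its values. This is
   used twice: with 1 to get the mass of [D], then with [g (X n o)]. *)
have intD (f : Omega -> R) (c : n.-tuple I -> R) :
    measurable_fun D (EFin \o f) -> (forall w o, A w o -> f o = c w) ->
    (\int[P]_(o in D) (f o)%:E = (#|I|%:R^-1 ^+ n * \sum_w c w)%:E)%E.
  move=> mf fc; rewrite integral_bigsetU_EFin// ?index_enum_uniq//.
  rewrite mulr_sumr -sumEFin; apply: eq_bigr => w _.
  rewrite (eq_integral (cst (c w)%:E)); last first.
    by move=> o; rewrite inE => /fc ->.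
  rewrite integral_cst// EFinM muleC; congr (_ * _)%E; exact: PA.
have PD : P D = 1%E.
  have m1 : measurable_fun D (EFin \o cst (1 : R)) by exact: (measurable_cst 1%:E).
  have := intD (cst 1) (cst 1) m1 (fun _ _ _ => erefl).
  rewrite (eq_integral (cst 1%:E))// integral_cst// mul1e => ->.
  rewrite sumr_const card_tuple natrX -exprMn mulVf ?expr1n//.
  by rewrite pnatr_eq0 -lt0n.
(* Off [D] the values of [g (X n o)] are uncontrolled, but that set is null by [PD]. *)
rewrite unlock /= -(setvU D) setUC integral_setU//; last 2 first.
- exact: measurableC.
- by apply/disj_setPS; rewrite setICr.
rewrite [X in (_ + X)%E]null_set_integral//; last 2 first.
- exact: measurableC.
- by rewrite -[LHS]/(P (~` D)) probability_setC// PD subee.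
rewrite adde0 iter_transition_op; apply: intD => // w o Aw.
by rewrite (Aw n)// take_oversize// size_tuple.
Qed.
End MarkovExpectation.

(** * Orientation of the streets and the moves of the walk *)

Definition street_sign (d : nat) (x : 'rV[int]_d) (i : 'I_d) : int :=
  if (2 %| \sum_(j < d | j != i) x 0 j)%Z then 1 else -1.

Definition manhattan_step (d : nat) (x : 'rV[int]_d) (i : 'I_d) : 'rV[int]_d :=
  x + street_sign x i *: unit_vec int i.

Lemma street_sign_sqr (d : nat) (x : 'rV[int]_d) (i : 'I_d) :
  street_sign x i * street_sign x i = 1.
Proof. by rewrite /street_sign; case: ifP. Qed.

Lemma manhattan_stepE (d : nat) (x : 'rV[int]_d) (i j : 'I_d) :
  manhattan_step x i 0 j = x 0 j + (if j == i then street_sign x i else 0).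
Proof.
rewrite /manhattan_step !mxE eqxx /=.
by case: eqP => _; rewrite ?mulr1 ?mulr0.
Qed.

(** Coordinate [i] changes under move [i], by a nonzero sign, and under no other move. *)
Lemma manhattan_step_inj (d : nat) (x : 'rV[int]_d) :
  injective (manhattan_step x).
Proof.
move=> i j /(congr1 (fun y : 'rV[int]_d => y 0 i)).
rewrite !manhattan_stepE eqxx => /addrI.
by case: eqP => // _ /eqP; rewrite /street_sign; case: ifP.
Qed.

Lemma manhattan_kernel_step (R : realType) (d : nat) (x : 'rV[int]_d) (i : 'I_d) :
  manhattan_kernel R x (manhattan_step x i) = d%:R^-1.
Proof.
rewrite /manhattan_kernel ifT//; apply/existsP; exists i.
rewrite /manhattan_step; case: ifP => h.
  have -> : street_sign x i = 1 by rewrite /street_sign h.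
  by rewrite scale1r.
have -> : street_sign x i = -1 by rewrite /street_sign h.
by rewrite scaleN1r.
Qed.

(** The sum deciding the sign at [j] omits coordinate [j]. A move along [j] is therefore invisible
    to it, while any other move changes one summand by 1 or -1 and flips its parity. *)
Lemma street_sign_step (d : nat) (x : 'rV[int]_d) (i j : 'I_d) :
  street_sign (manhattan_step x i) j =
  if j == i then street_sign x j else - street_sign x j.
Proof.
rewrite {1}/street_sign.
under eq_bigr do rewrite manhattan_stepE.
rewrite big_split /=.
case: eqP => [<-|/eqP ji].
  by rewrite [X in _ + X]big1 ?addr0// => k /negPf ->.
rewrite -big_mkcondr [X in _ + X](big_pred1 i); last first.
  by move=> k; rewrite /= andbC; case: eqP => //= ->; rewrite eq_sym.
rewrite [street_sign x j]/street_sign /street_sign.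
set a := \sum_(_ < _ | _ != i) _; set b := \sum_(_ < _ | _) _.
by case: (boolP (2 %| a)%Z); case: (boolP (2 %| b)%Z) => ? ?; case: ifP => //; lia.
Qed.

(** * One-step recurrences for the moments and their solutions *)

Section Moments.
Variables (R : realType) (d : nat).
Hypothesis hd : (2 <= d)%N.

Let r : R := (2 - d%:R) / d%:R.
Let T := transition_op (R := R) (@manhattan_step d).
Let s (x : 'rV[int]_d) (i : 'I_d) : R := (street_sign x i)%:~R.
Let drift (x : 'rV[int]_d) : R := \sum_(i < d) (x 0 i)%:~R * s x i.
Let normsq (x : 'rV[int]_d) : R := \sum_(i < d) (x 0 i)%:~R ^+ 2.

Let d_neq0 : d%:R != 0 :> R.
Proof. by rewrite pnatr_eq0 -lt0n ltnW. Qed.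

Let d_neq1 : d%:R - 1 != 0 :> R.
Proof. by rewrite subr_eq0 (eqr_nat _ d 1); case: d hd => [|[]]. Qed.

(** Source of [r]: with [a] = 1 and [b] = -1, dividing by d gives (2 - d)/d. *)
Lemma sum_if_diag (i : 'I_d) (a b : R) :
  \sum_(j < d) (if i == j then a else b) = a + b * (d%:R - 1).
Proof.
rewrite (bigD1 i)//= eqxx; congr (_ + _).
rewrite (eq_bigr (fun=> b)); last by move=> j; rewrite eq_sym => /negPf ->.
rewrite sumr_const cardC1 card_ord -[in RHS](prednK (ltnW hd)) -natr1 addrK.
by rewrite mulr_natr.
Qed.

Lemma transition_street_sign i x : T (fun y => s y i) x = r * s x i.
Proof.
rewrite /T /transition_op card_ord /s /r.
rewrite (eq_bigr (fun j => if i == j then s x i else - s x i)); last first.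
  by move=> j _; rewrite street_sign_step /s; case: eqP => // _; rewrite mulrNz.
by rewrite sum_if_diag /s; field.
Qed.

Lemma transition_coord i x :
  T (fun y => (y 0 i)%:~R) x = (x 0 i)%:~R + s x i / d%:R.
Proof.
rewrite /T /transition_op card_ord.
rewrite (eq_bigr (fun j => (x 0 i)%:~R + if i == j then s x i else 0)); last first.
  by move=> j _; rewrite manhattan_stepE intrD /s; case: eqP => [->|].
rewrite big_split/= sum_if_diag sumr_const card_ord -(mulr_natr (x 0 i)%:~R).
by field.
Qed.

(** The term at [j] keeps its sign and gains [s x j] squared, which is 1. All other terms are
    negated; the factor 2 compensates for negating the term at [j] as well. *)
Lemma drift_step x j :
  drift (manhattan_step x j) = 2 * ((x 0 j)%:~R * s x j) + 1 - drift x.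
Proof.
rewrite /drift (bigD1 j)//= [in RHS](bigD1 j)//= /s.
rewrite manhattan_stepE street_sign_step eqxx.
rewrite (eq_bigr (fun i => - ((x 0 i)%:~R * s x i))); last first.
  move=> i /negPf ij; rewrite manhattan_stepE street_sign_step ij addr0 /s.
  by rewrite mulrNz mulrN.
have s2 : s x j * s x j = 1 by rewrite /s -intrM street_sign_sqr.
rewrite sumrN intrD -/(s x j) mulrDl s2.
by ring.
Qed.

(** Averaging [drift_step] over [j] gives the coefficient 2/d - 1, which is [r]. *)
Lemma transition_drift x : T drift x = r * drift x + 1.
Proof.
rewrite /T /transition_op card_ord (eq_bigr _ (fun j _ => drift_step x j)).
rewrite big_split/= big_split/= -mulr_sumr -/(drift x) !sumr_const card_ord.
by rewrite -(mulr_natr (- drift x)) /r; field.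
Qed.

Lemma normsq_step x j :
  normsq (manhattan_step x j) = normsq x + 1 + 2 * ((x 0 j)%:~R * s x j).
Proof.
rewrite /normsq (bigD1 j)//= [in RHS](bigD1 j)//= /s manhattan_stepE eqxx.
rewrite (eq_bigr (fun i => (x 0 i)%:~R ^+ 2)); last first.
  by move=> i /negPf ij; rewrite manhattan_stepE ij addr0.
have s2 : s x j ^+ 2 = 1 by rewrite /s expr2 -intrM street_sign_sqr.
by rewrite intrD sqrrD -/(s x j) s2; ring.
Qed.

Lemma transition_normsq x : T normsq x = normsq x + 1 + 2 / d%:R * drift x.
Proof.
rewrite /T /transition_op card_ord (eq_bigr _ (fun j _ => normsq_step x j)).
rewrite big_split/= -mulr_sumr -/(drift x) !sumr_const card_ord.
by rewrite -(mulr_natr (normsq x + 1)); field.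
Qed.

(** The coefficient of [s x i] starts at 0 and obeys c' = 1/d + r c. The geometric sum has
    denominator d (1 - r) = 2 (d - 1). *)
Lemma iter_transition_coord n i x :
  iter n T (fun y => (y 0 i)%:~R) x =
  (x 0 i)%:~R + (1 - r ^+ n) / (2 * (d%:R - 1)) * s x i.
Proof.
elim: n x => [|n IH] x; first by rewrite expr0 subrr !mul0r addr0.
rewrite iterS; set c := (1 - r ^+ n) / _ in IH *.
(* The added 0 gives the shape expected by [transition_op_affine]. *)
have -> : iter n T (fun y => (y 0 i)%:~R) = fun y => (y 0 i)%:~R + c * s y i + 0.
  by apply/funext => y; rewrite IH addr0.
rewrite /T (transition_op_affine _ (fun y : 'rV_d => (y 0 i)%:~R) (fun y => s y i));
  last by rewrite card_ord ltnW.
rewrite -/T transition_coord (transition_street_sign i) /c exprS /r.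
by field; rewrite d_neq0 d_neq1.
Qed.

(** The coefficient of [drift] obeys b' = 2/d + r b from 0, so b = (1 - r^n)/(d - 1). The constant
    term grows by 1 + b at each step, and summing these increments gives the last bracket. *)
Lemma iter_transition_normsq n x :
  iter n T normsq x =
  normsq x + (1 - r ^+ n) / (d%:R - 1) * drift x
  + (n%:R + n%:R / (d%:R - 1) - d%:R * (1 - r ^+ n) / (2 * (d%:R - 1) ^+ 2)).
Proof.
elim: n x => [|n IH] x; first by rewrite expr0 subrr mulr0n !(mulr0, mul0r, subr0, addr0).
rewrite iterS (funext IH) /T (transition_op_affine _ normsq drift);
  last by rewrite card_ord ltnW.
rewrite -/T transition_normsq transition_drift (exprS r n) -[n.+1%:R]natr1 /r.
by field; rewrite d_neq0 d_neq1.
Qed.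
End Moments.

Theorem theorem1 (R : realType) (disp : measure_display)
    (Omega : measurableType disp) (P : probability Omega R) (d : nat)
    (hd : (2 <= d)%N) (X : nat -> Omega -> 'rV[int]_d)
    (hX : manhattan_walk P X) (n : nat) :
  expectation_vec P (X n) =
    map_mx EFin
      (((1 - ((2 - d%:R) / d%:R) ^+ n) / (2 * (d%:R - 1)))
       *: \sum_(i < d) unit_vec R i) /\
  ('E_P[fun w => (euclidean_norm R (X n w) ^+ 2)%R])%E =
    (((2 * (d%:R - 1) * n%:R - 1) * d%:R ^+ n + (2 - d%:R) ^+ n)
     / (d%:R ^ (n%:Z - 1) * (2 * (d%:R - 1) ^+ 2)))%:E.
Proof.
have d0 : (0 < #|'I_d|)%N by rewrite card_ord ltnW.
have d_neq0 : d%:R != 0 :> R by rewrite pnatr_eq0 -lt0n ltnW.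
have d_neq1 : d%:R - 1 != 0 :> R.
  by rewrite subr_eq0 (eqr_nat _ d 1); case: d hd {X hX d0 d_neq0} => [|[]].
have kernel_step x i :
    manhattan_kernel R x (@manhattan_step d x i) = #|'I_d|%:R^-1.
  by rewrite card_ord manhattan_kernel_step.
have expectationE :=
  expectation_markov_chain (@manhattan_step_inj d) kernel_step hX n _ d0.
split.
  apply/rowP => i; rewrite !mxE (expectationE (fun x => (x 0 i)%:~R)).
  rewrite iter_transition_coord// mxE add0r summxE (bigD1 i)//= mxE !eqxx.
  rewrite big1 ?addr0; last by move=> j /negPf ji; rewrite mxE eq_sym ji andbF.
  (* At the origin the parity sum is 0, hence even: every sign is 1, and all coordinates have the
     same mean. *)
  rewrite /street_sign big1 ?dvdz0//; last by move=> j _; rewrite mxE.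
rewrite (_ : (fun w => _) = (fun w => \sum_(i < d) (X n w 0 i)%:~R ^+ 2)).
  rewrite (expectationE (fun x => \sum_(i < d) (x 0 i)%:~R ^+ 2)).
  rewrite iter_transition_normsq//; congr EFin.
  (* At the origin both [normsq] and [drift] vanish, leaving only the constant term. *)
  rewrite !big1; try by move=> i _; rewrite mxE ?mul0r ?expr0n.
  (* The exponent n - 1 is an integer, equal to -1 at n = 0, so the power is split as d^n times the
     inverse of d. *)
  rewrite mulr0 !add0r expfzDr// exprN1 -exprnP expr_div_n.
  by field; rewrite d_neq1 d_neq0 expf_neq0.
apply/funext => w; rewrite /euclidean_norm sqr_sqrtr//.
by apply: sumr_ge0 => i _; exact: sqr_ge0.
Qed.
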